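(* Let $\mathcal{X}\subset\Omega^\alpha_T$ be locally compact and second countable, and such that $\mathcal{K}_\Phi:\mathcal{X}\times\mathcal{X}\to\mathbb{R}$ is measurable. Let $\mathbb{Q}$ be a probability measure supported on $\mathcal{X}$, let $\pi:\Omega^\alpha_T\to\mathbb{R}$ be a payoff (measurable) and $\pi_0\in\mathbb{R}$. Assume $$\int_{\mathcal{X}}\mathcal{K}_\Phi(\mathbf{X},\mathbf{X})\,d\mathbb{Q}(\mathbf{X})<+\infty,\qquad \int_{\mathcal{X}}\pi(\mathbf{X})^2\,d\mathbb{Q}(\mathbf{X})<+\infty .$$ Let $\lambda>0$ and define $\Xi^\Phi_{\mathbb{Q}}:L^2_{\mathbb{Q}}(\mathcal{X})\to L^2_{\mathbb{Q}}(\mathcal{X})$ by $$\Xi^\Phi_{\mathbb{Q}}(\alpha)(\mathbf{X})=\mathbb{E}_{\mathbf{Y}\sim\mathbb{Q}}\big[\alpha(\mathbf{Y})\,\mathcal{K}_\Phi(\mathbf{Y},\mathbf{X})\big]=\Big\langle \mathbb{E}_{\mathbf{Y}\sim\mathbb{Q}}[\alpha(\mathbf{Y})\Phi_{\mathbf{Y}}],\Phi_{\mathbf{X}}\Big\rangle_{\mathcal{H}_K}.$$ Then for $f^*\in\mathcal{H}_\Phi$, $$f^*\in\arg\min_{f\in\mathcal{H}_\Phi}\left\{\mathbb{E}_{\mathbf{X}\sim\mathbb{Q}}\left[\left(\pi(\mathbf{X})-\pi_0-\int_0^T\langle f(\mathbf{X}|_{[0,t]}),d\mathbf{X}_t\rangle_{\mathbb{R}^d}\right)^2\right]+\frac{\lambda}{2}\|f\|_{\mathcal{H}_\Phi}^2\right\}$$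 if and only if there is $\alpha^*\in L^2_{\mathbb{Q}}(\mathcal{X})$ such that $$\left(\tfrac12 \mathrm{Id}+\tfrac1\lambda\,\Xi^\Phi_{\mathbb{Q}}\right)(\alpha^* )(\mathbf{X})=\pi_0-\pi(\mathbf{X})\quad\text{(as elements of } L^2_{\mathbb{Q}}(\mathcal{X}))$$ and $$f^*=-\frac1\lambda\,\mathbb{E}_{\mathbf{X}\sim\mathbb{Q}}[\alpha^*(\mathbf{X})\Phi_{\mathbf{X}}]\in\mathcal{H}_\Phi\subseteq\mathcal{H}_K .$$
   Context: Fix $d\ge1$, $T>0$, $\alpha\in(0,1)$, $N=\lfloor 1/\alpha\rfloor$. An $\alpha$-Hölder rough path on $[0,t]$ is a continuous map $\mathbf{X}:\{0\le r\le u\le t\}\to T^{(N)}(\mathbb{R}^d)=\bigoplus_{m=0}^N(\mathbb{R}^d)^{\otimes m}$, $\mathbf{X}=(1,X^1,\dots,X^N)$, satisfying Chen's relation $\mathbf{X}_{r,u}\otimes\mathbf{X}_{u,v}=\mathbf{X}_{r,v}$ and $|\langle\mathbf{X}_{r,u},e_I\rangle|\le C|u-r|^{|I|\alpha}$ for all words $I$ in the letters $1,\dots,d$ with $|I|\le N$ ($e_I=e_{i_1}\otimes\cdots\otimes e_{i_k}$ for $I=i_1\cdots i_k$; $\mathbf{X}^I$ denotes the coefficient). $\Omega^\alpha_t$ is the (metric) space of $\alpha$-Hölder rough paths over $\mathbb{R}^d$ on $[0,t]$ with a fixed starting point $x\in\mathbb{R}^d$, and $\Lambda^\alpha=\bigcup_{t\in[0,T]}\Omega^\alpha_t$.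 $\mathbf{X}|_{[0,t]}$ is restriction to $[0,t]$. For a set $\mathcal{Z}$ and a real Hilbert space $\mathcal{Y}$, an $\mathcal{L}(\mathcal{Y})$-valued kernel is a map $K:\mathcal{Z}\times\mathcal{Z}\to\mathcal{L}(\mathcal{Y})$ with $K(z,z')=K(z',z)^T$ and all matrices $(\langle K(z_i,z_j)y_i,y_j\rangle_{\mathcal{Y}})_{i,j}$ positive semidefinite. Its RKHS $\mathcal{H}_K\subseteq\{\mathcal{Z}\to\mathcal{Y}\}$ is the Hilbert space that is the closure of the span of the elements $K(z,\cdot)y$, with $\langle\phi,K(z,\cdot)y\rangle_{\mathcal{H}_K}=\langle\phi(z),y\rangle_{\mathcal{Y}}$. Let $K:\Lambda^\alpha\times\Lambda^\alpha\to\mathcal{L}(\mathbb{R}^d)$ be an operator-valued kernel. Standing assumption: for each $\mathbf{X}\in\Omega^\alpha_T$ there is a given path $\boldsymbol{K}(\mathbf X)=(K^0,\dots,K^{N-1}):[0,T]\to\bigoplus_{m=0}^{N-1}\mathcal{L}((\mathbb{R}^d)^{\otimes m};\mathcal{L}(\mathbb{R}^d;\mathcal{H}_K))$ with $K^0(\mathbf X)_s=K(\mathbf{X}|_{[0,s]},\cdot)$ and a constant $C$ such that, for all words $|I|\le N-1$ and $0\le s\le t\le T$, $\|\boldsymbol{K}(\mathbf X)_t[e_I]-\boldsymbol{K}(\mathbf X)_s[\mathbf{X}_{s,t}\otimes e_I]\|\le C|t-s|^{(N-|I|)\alpha}$ and $\|\boldsymbol{K}(\mathbf X)_t[e_I]-\boldsymbol{K}(\mathbf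 X)_s[e_I]\|\le C|t-s|^{\alpha}$ (tensor $\mathbf{X}_{s,t}\otimes e_I$ truncated at level $N-1$). Then the limit over partitions $\mathcal{P}$ of $[0,T]$ with mesh tending to $0$, $$\Phi_{\mathbf{X}}:=\int_0^TK(\mathbf{X}|_{[0,t]},\cdot)\,d\mathbf{X}_t:=\lim_{|\mathcal{P}|\to0}\sum_{[s,t]\in\mathcal{P}}\sum_{|I|\le N-1}\sum_{k=1}^d\mathbf{X}^{Ik}_{s,t}\,(\boldsymbol{K}(\mathbf X)_s[e_I])[e_k]\in\mathcal{H}_K$$ exists, and for $f\in\mathcal{H}_K$ the rough integral $\int_0^T\langle f(\mathbf{X}|_{[0,t]}),d\mathbf{X}_t\rangle$ is $\lim_{|\mathcal{P}|\to0}\sum_{[s,t]}\sum_{|I|\le N-1}\sum_k\mathbf{X}^{Ik}_{s,t}\langle f,(\boldsymbol{K}(\mathbf X)_s[e_I])[e_k]\rangle_{\mathcal{H}_K}=\langle f,\Phi_{\mathbf{X}}\rangle_{\mathcal{H}_K}$. $\mathcal{K}_\Phi(\mathbf{X},\mathbf{Y})=\langle\Phi_{\mathbf{X}},\Phi_{\mathbf{Y}}\rangle_{\mathcal{H}_K}$ is a real-valued kernel on $\Omega^\alpha_T$; its RKHS $\mathcal{H}_\Phi$ is identified with the closure of $\mathrm{Span}\{\Phi_{\mathbf{X}}:\mathbf{X}\in\Omega^\alpha_T\}$ in $\mathcal{H}_K$, with inner product $\langle\cdot,\cdot\rangle_{\mathcal{H}_K}$. *)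

(* Defs.v *)
From HB Require Import structures.
From mathcomp Require Import all_boot all_order all_algebra archimedean.
From mathcomp Require Import sesquilinear.
From mathcomp Require Import all_classical all_reals all_analysis.

Set Implicit Arguments.
Unset Strict Implicit.
Unset Printing Implicit Defensive.

Import Order.TTheory GRing.Theory Num.Theory.
Import numFieldNormedType.Exports.

Local Open Scope classical_set_scope.
Local Open Scope ring_scope.

(* A tensor over R^d is given by its coefficients on the words in the letters
   'I_d; the word [:: i1; ..; ik] stands for e_i1 (x) .. (x) e_ik.  An element
   of T^(N)(R^d) is such a family supported on the words of length at most N;
   truncation at level N simply ignores longer words. *)

Definition word (d : nat) := seq 'I_d.

Definition tensor (R : realType) (d : nat) := word d -> R.

Section tensors.
Context {R : realType} {d : nat}.
Implicit Types (a b : tensor R d) (I J : word d).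

Definition tmul a b : tensor R d :=
  fun I => \sum_(k < (size I).+1) a (take k I) * b (drop k I).

Definition eword I : tensor R d := fun J => (J == I)%:R.

(* Sum over all words of length < n. *)
Definition wsum (V : nmodType) (n : nat) (F : word d -> V) : V :=
  \sum_(m < n) \sum_(I : m.-tuple 'I_d) F I.

End tensors.

Section rough_paths.
Context {R : realType} {d : nat}.

Definition level (alpha : R) : nat := Num.truncn alpha^-1.

Definition simplex (t : R) : set (R * R) :=
  [set p | [/\ 0 <= p.1, p.1 <= p.2 & p.2 <= t]].

(* [rp_out] makes the representation of a map defined on the simplex and with
   values in the truncated tensor algebra unique. *)
Record is_rough_path (alpha t : R) (X : R -> R -> tensor R d) : Prop := {
  rp_continuous : forall I, (size I <= level alpha)%N ->
    {within simplex t, continuous (fun p : R * R => X p.1 p.2 I)} ;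
  rp_unit : forall r u, simplex t (r, u) -> X r u [::] = 1 ;
  rp_chen : forall r u v, 0 <= r -> r <= u -> u <= v -> v <= t ->
    forall I, (size I <= level alpha)%N -> tmul (X r u) (X u v) I = X r v I ;
  rp_hoelder : exists C : R, forall r u, simplex t (r, u) ->
    forall I, (size I <= level alpha)%N ->
    `|X r u I| <= C * (u - r) `^ ((size I)%:R * alpha) ;
  rp_out : forall r u I,
    ~ (simplex t (r, u) /\ (size I <= level alpha)%N) -> X r u I = 0 }.

(* The starting point x of the underlying path t |-> x + X^1_{0,t} is the same
   for all elements, so that only the increments need to be recorded. *)
Record rough_path (alpha : R) (x : 'cV[R]_d) (t : R) := RoughPath {
  rp_incr :> R -> R -> tensor R d ;
  rp_is_rough_path : is_rough_path alpha t rp_incr }.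

HB.instance Definition _ alpha x t := gen_eqMixin (rough_path alpha x t).
HB.instance Definition _ alpha x t := gen_choiceMixin (rough_path alpha x t).

Section theory.
Context {alpha : R} {x : 'cV[R]_d} {t : R}.
Implicit Types X Y Z : rough_path alpha x t.

Lemma rough_path_eq X Y :
  (forall r u I, simplex t (r, u) -> (size I <= level alpha)%N ->
     X r u I = Y r u I) -> X = Y.
Proof.
move=> XY; have E : X = Y :> (R -> R -> tensor R d).
  apply/funext => r; apply/funext => u; apply/funext => I.
  have [[ru sI]|H] := pselect (simplex t (r, u) /\ (size I <= level alpha)%N).
    exact: XY.
  by rewrite (rp_out (rp_is_rough_path X)) // (rp_out (rp_is_rough_path Y)).
case: X Y E {XY} => [f pf] [g pg] /= fg; case: _ / fg pg => pg.
by rewrite (Prop_irrelevance pf pg).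
Qed.

Lemma trivial_rough_path_subproof : is_rough_path alpha t
  (fun r u I => `[< simplex t (r, u) >]%:R * (I == [::])%:R).
Proof.
split.
- move=> I _; apply: (@subspace_eq_continuous _ _ _
    (fun=> (I == [::])%:R : R)); last exact/continuous_subspaceT/cst_continuous.
  by move=> p /set_mem; case: p => r u tru; rewrite /from_subspace /= asboolT// mul1r.
- by move=> r u ru; rewrite asboolT// mul1r.
- move=> r u v r0 ru uv vt I _.
  have sru : simplex t (r, u) by split => //=; exact: le_trans vt.
  have suv : simplex t (u, v) by split => //=; exact: le_trans ru.
  have srv : simplex t (r, v) by split => //=; exact: le_trans uv.
  rewrite /tmul !asboolT// !mul1r big_ord_recl /= take0 drop0 eqxx !mul1r.
  rewrite big1 ?addr0// => i _; rewrite mul1r.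
  by case: I i => [[]//|a I i] /=; rewrite mul0r.
- exists 1 => r u ru I _; rewrite asboolT// !mul1r.
  case: I => [|a I] /=; last by rewrite normr0 powR_ge0.
  by rewrite normr1 mul0r powRr0.
- move=> r u I; have [ru|] := pselect (simplex t (r, u)); last first.
    by move=> nru _; rewrite asboolF// mul0r.
  case: I => [|a I]; last by rewrite mulr0.
  by move=> /not_andP[].
Qed.

HB.instance Definition _ := isPointed.Build (rough_path alpha x t)
  (RoughPath x trivial_rough_path_subproof).

(* The (inhomogeneous) alpha-Hoelder rough path metric. *)
Definition rp_ratio X Y : set R :=
  [set q | exists r u I, [/\ 0 <= r, r < u, u <= t, (size I <= level alpha)%N &
     q = `|X r u I - Y r u I| / (u - r) `^ ((size I)%:R * alpha)]].

Definition rp_dist X Y : R := sup (rp_ratio X Y).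

Lemma rp_ratio_ub X Y : has_ubound (rp_ratio X Y).
Proof.
have [C HC] := rp_hoelder (rp_is_rough_path X).
have [D HD] := rp_hoelder (rp_is_rough_path Y).
exists (C + D) => _ [r [u [I [r0 ru ut sI ->]]]].
have sru : simplex t (r, u) by split => //=; exact: ltW.
rewrite ler_pdivrMr; last by rewrite powR_gt0 // subr_gt0.
rewrite mulrDl (le_trans (ler_normB _ _))//.
by apply: lerD; [exact: HC|exact: HD].
Qed.

Lemma rp_dist_ge0 X Y : 0 <= rp_dist X Y.
Proof.
rewrite /rp_dist; have [->|/set0P[q Hq]] := eqVneq (rp_ratio X Y) set0.
  by rewrite sup0.
apply: (@le_trans _ _ q); last by apply: ub_le_sup => //; exact: rp_ratio_ub.
by case: Hq => r [u [I [_ _ _ _ ->]]]; rewrite divr_ge0// powR_ge0.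
Qed.

Lemma rp_ratio_le X Y q : rp_ratio X Y q -> q <= rp_dist X Y.
Proof. by move=> H; apply: ub_le_sup => //; exact: rp_ratio_ub. Qed.

Lemma rp_dist_le X Y M : 0 <= M -> (forall q, rp_ratio X Y q -> q <= M) ->
  rp_dist X Y <= M.
Proof.
move=> M0 HM; rewrite /rp_dist.
have [->|/set0P ne] := eqVneq (rp_ratio X Y) set0; first by rewrite sup0.
exact: ge_sup.
Qed.

Lemma rp_distxx X : rp_dist X X = 0.
Proof.
apply/eqP; rewrite eq_le rp_dist_ge0 andbT; apply: rp_dist_le => // q.
by case=> r [u [I [_ _ _ _ ->]]]; rewrite subrr normr0 mul0r.
Qed.

Lemma rp_dist_positivity X Y : rp_dist X Y = 0 -> X = Y.
Proof.
move=> XY0; apply: rough_path_eq => r u I /[dup] sru [/= r0 ru ut] sI.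
move: ru; rewrite le_eqVlt => /predU1P[ru|ru].
  subst u; case: I sI => [|i I] sI.
    by rewrite (rp_unit (rp_is_rough_path X))// (rp_unit (rp_is_rough_path Y)).
  have alpha0 : (size (i :: I))%:R * alpha != 0.
    rewrite mulf_neq0 ?pnatr_eq0//; apply: contraTneq sI => ->.
    by rewrite /level invr0 Num.Theory.truncn0.
  suff Z0 Z : Z r r (i :: I) = 0 by rewrite !Z0.
  have [C /(_ _ _ sru _ sI)] := rp_hoelder (rp_is_rough_path Z).
  by rewrite subrr powR0// mulr0 normr_le0 => /eqP.
have : rp_ratio X Y (`|X r u I - Y r u I| / (u - r) `^ ((size I)%:R * alpha)).
  by exists r, u, I.
move=> /rp_ratio_le; rewrite XY0 ler_pdivrMr ?mul0r; last first.
  by rewrite powR_gt0// subr_gt0.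
by rewrite normr_le0 subr_eq0 => /eqP.
Qed.

Lemma rp_dist_sym X Y : rp_dist X Y = rp_dist Y X.
Proof.
by congr sup; apply/seteqP; split=> q [r [u [I [? ? ? ? ->]]]];
  exists r, u, I; split => //; rewrite distrC.
Qed.

Lemma rp_dist_triangle Y X Z : rp_dist X Z <= rp_dist X Y + rp_dist Y Z.
Proof.
apply: rp_dist_le; first by rewrite addr_ge0// rp_dist_ge0.
move=> _ [r [u [I [r0 ru ut sI ->]]]].
apply: (@le_trans _ _ (`|X r u I - Y r u I| / (u - r) `^ ((size I)%:R * alpha)
  + `|Y r u I - Z r u I| / (u - r) `^ ((size I)%:R * alpha))).
  by rewrite -mulrDl ler_wpM2r ?invr_ge0 ?powR_ge0// ler_distD.
by apply: lerD; apply: rp_ratio_le; exists r, u, I.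
Qed.

HB.instance Definition _ := isMetric.Build R (rough_path alpha x t)
  rp_distxx rp_dist_positivity rp_dist_sym rp_dist_triangle.

Lemma restrict_subproof X s : s <= t -> is_rough_path alpha s
  (fun r u I => if `[< simplex s (r, u) >] then X r u I else 0).
Proof.
move=> st; have pX := rp_is_rough_path X.
have sub r u : simplex s (r, u) -> simplex t (r, u).
  by move=> [/= ? ? us]; split => //=; exact: le_trans st.
split.
- move=> I sI; apply: (@subspace_eq_continuous _ _ _
    (fun p : R * R => X p.1 p.2 I)).
    by move=> [r u] /set_mem sru; rewrite /from_subspace /= asboolT.
  apply: continuous_subspaceW (rp_continuous pX sI) => -[r u]; exact: sub.
- by move=> r u sru; rewrite asboolT// (rp_unit pX)//; exact: sub.
- move=> r u v r0 ru uv vs I sI.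
  have sru : simplex s (r, u) by split => //=; exact: le_trans vs.
  have suv : simplex s (u, v) by split => //=; exact: le_trans ru.
  have srv : simplex s (r, v) by split => //=; exact: le_trans uv.
  rewrite /tmul !asboolT//; apply: (rp_chen pX) => //; exact: le_trans st.
- have [C HC] := rp_hoelder pX; exists C => r u sru I sI.
  by rewrite asboolT//; apply: HC => //; exact: sub.
- move=> r u I H; case: asboolP => // sru; apply: (rp_out pX) => -[_ sI].
  exact: H.
Qed.

End theory.

End rough_paths.

(* The union of the spaces of rough paths on [0, t], for t in [0, T]. *)
Record stopped_path (R : realType) (d : nat) (alpha : R) (x : 'cV[R]_d)
    (T : R) := StoppedPath {
  sp_time : R ;
  sp_time_itv : 0 <= sp_time <= T ;
  sp_path : rough_path alpha x sp_time }.

Definition stop (R : realType) (d : nat) (alpha : R) (x : 'cV[R]_d) (T : R)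
    (X : rough_path alpha x T) (s : R) (hs : 0 <= s <= T) :
    stopped_path alpha x T :=
  StoppedPath hs (RoughPath x (restrict_subproof X (proj2 (andP hs)))).

Section kernels.
Context {R : realType}.

Definition dotv (n : nat) (u v : 'cV[R]_n) : R := (u^T *m v) 0 0.

Definition enorm (n : nat) (u : 'cV[R]_n) : R := Num.sqrt (dotv u u).

Definition psd (n : nat) (A : 'M[R]_n) : Prop :=
  A^T = A /\ forall c : 'cV[R]_n, 0 <= dotv c (A *m c).

Definition operator_kernel (Z : Type) (d : nat) (K : Z -> Z -> 'M[R]_d) :=
  (forall z z', K z z' = (K z' z)^T) /\
  (forall n (z : 'I_n -> Z) (y : 'I_n -> 'cV[R]_d),
     psd (\matrix_(i, j) dotv (K (z i) (z j) *m y i) (y j))).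

Definition lin_span (V : lmodType R) (A : set V) : set V :=
  [set v | exists (n : nat) (c : 'I_n -> R) (a : 'I_n -> V),
     (forall i, A (a i)) /\ v = \sum_i c i *: a i].

(* [rk_fun] realizes the abstract Hilbert space as a space of functions from
   Z to R^d, and [rk_elt z] is K(z, .), as an element of L(R^d; H_K). *)
Record rkhs (Z : Type) (d : nat) (K : Z -> Z -> 'M[R]_d) := RKHS {
  rk_space :> completeNormedModType R ;
  rk_dot : {dot rk_space for idfun} ;
  rk_norm : forall h, `|h| ^+ 2 = rk_dot h h ;
  rk_fun : rk_space -> Z -> 'cV[R]_d ;
  rk_fun_linear : forall z, linear (rk_fun ^~ z) ;
  rk_fun_inj : injective rk_fun ;
  rk_elt : Z -> 'cV[R]_d -> rk_space ;
  rk_eltE : forall z y z', rk_fun (rk_elt z y) z' = K z z' *m y ;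
  rk_reproducing : forall phi z y,
    rk_dot phi (rk_elt z y) = dotv (rk_fun phi z) y ;
  rk_dense :
    closure (lin_span [set h | exists z y, h = rk_elt z y]) = setT }.

(* The operator norm on L(R^d; H). *)
Definition opnorm (d : nat) (H : normedModType R) (A : 'cV[R]_d -> H) : R :=
  sup [set `|A y| | y in [set y | enorm y <= 1]].

End kernels.

Section rough_integrals.
Context {R : realType}.

Definition intervals (P : seq R) : seq (R * R) := zip (0 :: P) P.

Definition mesh (P : seq R) : R :=
  \big[Num.max/0]_(p <- intervals P) (p.2 - p.1).

(* The filter "|P| -> 0" on the partitions P of [0, T]; the initial point 0 of
   a partition is left implicit. *)
Definition mesh_to0 (T : R) : set_system (seq R) :=
  filter_from [set e | 0 < e]
    (fun e => [set P | itv_partition 0 T P /\ mesh P < e]).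

Definition sewing_sum (V : nmodType) (Xi : R -> R -> V) (P : seq R) : V :=
  \sum_(p <- intervals P) Xi p.1 p.2.

Context {d : nat} {alpha T : R} {x : 'cV[R]_d}.
Context {K : stopped_path alpha x T -> stopped_path alpha x T -> 'M[R]_d}.
Context {HK : rkhs K}.

(* [KK X s I] is the operator K(X)_s[e_I] in L(R^d; H_K); only the words I of
   length at most N - 1 are relevant. *)
Implicit Type
  KK : rough_path alpha x T -> R -> word d -> {linear 'cV[R]_d -> HK}.
Implicit Types X Y : rough_path alpha x T.

(* K(X)_s[a], where the tensor a is truncated at level N - 1. *)
Definition KK_apply KK X (s : R) (a : tensor R d) (y : 'cV[R]_d) : HK :=
  wsum (level alpha) (fun J => a J *: KK X s J y).

Definition controlled KK : Prop := forall X,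
  (forall s (hs : 0 <= s <= T) y, KK X s [::] y = rk_elt HK (stop X hs) y) /\
  exists C : R, forall I s t, (size I < level alpha)%N ->
    0 <= s -> s <= t -> t <= T ->
    opnorm (fun y => KK X t I y - KK_apply KK X s (tmul (X s t) (eword I)) y)
      <= C * (t - s) `^ ((level alpha - size I)%:R * alpha) /\
    opnorm (fun y => KK X t I y - KK X s I y) <= C * (t - s) `^ alpha.

Definition Phi KK X : HK :=
  lim (sewing_sum (fun s t => wsum (level alpha) (fun I =>
    \sum_(k < d) X s t (rcons I k) *: KK X s I (delta_mx k 0)))
    @ mesh_to0 T).

Definition rough_int KK (f : HK) X : R :=
  lim (sewing_sum (fun s t => wsum (level alpha) (fun I =>
    \sum_(k < d) X s t (rcons I k) * rk_dot HK f (KK X s I (delta_mx k 0))))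
    @ mesh_to0 T).

Definition K_Phi KK X Y : R := rk_dot HK (Phi KK X) (Phi KK Y).

(* The RKHS of K_Phi, as a closed subspace of H_K with the norm of H_K. *)
Definition H_Phi KK : set HK := closure (lin_span (range (Phi KK))).

End rough_integrals.

Definition borel (T : ptopologicalType) := g_sigma_algebraType (@open T).

(* The integral over D of a function F with values in a Hilbert space, in the
   weak sense.  It agrees with the Bochner integral whenever the latter exists.
   Measurability of (X, Y) |-> <F X, F Y> and square integrability of F give
   the existence of the weak integral, but not strong measurability of F, since
   H need not be separable. *)
Definition is_weak_integral (R : realType) (H : lmodType R)
    (dot : {dot H for idfun}) (dsp : measure_display)
    (T : measurableType dsp) (mu : {measure set T -> \bar R}) (D : set T)
    (F : T -> H) (h : H) : Prop :=
  forall g : H, mu.-integrable D (fun X => (dot (F X) g)%:E) /\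
    dot h g = \int[mu]_(X in D) dot (F X) g.

Definition is_argmin (R : realType) (V : Type) (J : V -> \bar R) (D : set V)
    (f : V) : Prop :=
  D f /\ forall g, D g -> (J f <= J g)%E.

Section hedging.
Context {R : realType} {d : nat} {alpha T : R} {x : 'cV[R]_d}.
Context {K : stopped_path alpha x T -> stopped_path alpha x T -> 'M[R]_d}.
Context {HK : rkhs K}.
Variable KK : rough_path alpha x T -> R -> word d -> {linear 'cV[R]_d -> HK}.
Variable Q : probability (borel (rough_path alpha x T)) R.
Variable XX : set (rough_path alpha x T).

Definition Xi_Phi (a : rough_path alpha x T -> R) (X : rough_path alpha x T) :
    R :=
  \int[Q]_(Y in XX) (a Y * K_Phi KK Y X).

Definition hedging_loss (payoff : rough_path alpha x T -> R) (pi0 lambda : R)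
    (f : HK) : \bar R :=
  (\int[Q]_(X in XX) ((payoff X - pi0 - rough_int KK f X) ^+ 2)%:E
   + (lambda / 2 * `|f| ^+ 2)%:E)%E.

End hedging.

(* Main.v *)
(* The germ of the rough integral is almost additive with exponent
   (N + 1) alpha > 1, so by the sewing lemma the integral converges in norm and
   commutes with inner products: the rough integral of f against X is
   <f, Phi_X>.  The problem is thereby a regularized least squares problem in
   H_Phi, whose minimizers f are characterized by the Euler-Lagrange equation
   lambda <f, g> = 2 E[(pi - pi0 - <f, Phi>) <g, Phi>] for all g.  With
   a = - 2 (pi - pi0 - <f, Phi>) it reads f = - lambda^-1 E[a Phi], and the
   definition of a becomes the linear equation for a. *)

Require Import Defs.
From HB Require Import structures.
From mathcomp Require Import all_boot all_order all_algebra archimedean.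
From mathcomp Require Import sesquilinear.
From mathcomp Require Import all_classical all_reals all_analysis.
From mathcomp Require Import measurable_realfun ssrAC ring lra.

Set Implicit Arguments.
Unset Strict Implicit.
Unset Printing Implicit Defensive.

Import Order.TTheory GRing.Theory Num.Theory.
Import numFieldNormedType.Exports.

Local Open Scope classical_set_scope.
Local Open Scope ring_scope.

(** * Hilbert spaces *)

(** The obstacle is that [HK] need not be separable and only the scalar kernel is assumed
    measurable, so E[a Phi] is a weak integral, tested against every g in H_K. Variations of f,
    however, are allowed only inside H_Phi, and measurability is at first known only for pairings
    with Phi_Y, Y in [XX]. Orthogonal projection closes both gaps: on the span of Phi over [XX] it
    gives measurability of X |-> <Phi_X, g> for all g, and on H_Phi it extends the Euler-Lagrange
    equation to all of H_K. Integration over [XX] also requires [XX] to be Borel, which is deduced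
    from local compactness and second countability. *)

Section inner_product.
Context {R : realType} {H : completeNormedModType R}.
Variable D : {dot H for idfun}.
Hypothesis normD : forall h, `|h| ^+ 2 = D h h.

Lemma dotC u v : D u v = D v u.
Proof. by rewrite hermitian_subproof expr0 mul1r. Qed.

Lemma dotDl u v w : D (u + v) w = D u w + D v w.
Proof. exact: linearDl. Qed.

Lemma dotZl a u w : D (a *: u) w = a * D u w.
Proof. exact: linearZl_LR. Qed.

Lemma dotDr u v w : D w (u + v) = D w u + D w v.
Proof. exact: linearDr. Qed.

Lemma dotZr a u w : D w (a *: u) = a * D w u.
Proof. exact: linearZr_LR. Qed.

Lemma dotNl u w : D (- u) w = - D u w.
Proof. exact: linearNl. Qed.

Lemma dotNr u w : D w (- u) = - D w u.
Proof. exact: linearNr. Qed.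

Lemma normDsqr u v : `|u + v| ^+ 2 = `|u| ^+ 2 + 2 * D u v + `|v| ^+ 2.
Proof. rewrite !normD dotDl !dotDr (dotC v u); ring. Qed.

(** The triangle inequality is part of the normed structure; squaring it and expanding with
    [normDsqr] gives the bound, the reverse of the usual derivation. *)
Lemma CauchySchwarz u v : `|D u v| <= `|u| * `|v|.
Proof.
have CS x y : D x y <= `|x| * `|y|.
  have : `|x + y| ^+ 2 <= (`|x| + `|y|) ^+ 2.
    by rewrite ler_pXn2r ?nnegrE ?addr_ge0 ?ler_normD.
  rewrite normDsqr sqrrD -mulr_natl; lra.
by rewrite ler_norml lerNl -dotNl -{1}(normrN u) !CS.
Qed.

Lemma continuous_dot f : continuous (D f : H -> R).
Proof.
have M : 0 < `|f| + 1 by rewrite ltr_pwDr.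
move=> h; apply/cvgrPdist_lt => e e0; near=> k.
rewrite -linearBr/= (le_lt_trans (CauchySchwarz _ _))//.
rewrite (@le_lt_trans _ _ ((`|f| + 1) * `|h - k|))//.
  by rewrite ler_wpM2r// lerDl.
rewrite mulrC -ltr_pdivlMr//; near: k.
by apply: cvgr_dist_lt; rewrite ?divr_gt0.
Unshelve. all: by end_near. Qed.

End inner_product.

Section linear_span.
Context {R : realType} {V : lmodType R}.
Implicit Types A : set V.

Lemma lin_span0 A : lin_span A 0.
Proof. by exists 0, (fun=> 0), (fun=> 0); split; [case|rewrite big_ord0]. Qed.

Lemma sub_lin_span A : A `<=` lin_span A.
Proof.
move=> a Aa; exists 1, (fun=> 1), (fun=> a); split => //.
by rewrite big_ord1 scale1r.
Qed.

Lemma lin_spanP A k u v : lin_span A u -> lin_span A v ->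
  lin_span A (k *: u + v).
Proof.
move=> [n [c [a [Aa ->]]]] [m [d [b [Ab ->]]]].
exists (n + m)%N,
  (fun i => match fintype.split i with inl j => k * c j | inr j => d j end),
  (fun i => match fintype.split i with inl j => a j | inr j => b j end); split.
  by move=> i; case: (fintype.split i).
rewrite big_split_ord/= scaler_sumr; congr (_ + _); apply: eq_bigr => i _.
  by rewrite (unsplitK (inl i)) scalerA.
by rewrite (unsplitK (inr i)).
Qed.

End linear_span.

Section closure.
Context {R : realType} {H : normedModType R}.
Implicit Types A : set H.

Lemma closure_normP A p :
  closure A p <-> forall e, 0 < e -> exists2 s, A s & `|p - s| < e.
Proof.
split=> [clA e e0|clA B /nbhs_normP[e /= e0 eB]].
  have [s [As ps]] := clA _ (nbhsx_ballx p _ e0).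
  by exists s; rewrite // -ball_normE in ps.
by have [s As ps] := clA _ e0; exists s; split => //; exact: eB.
Qed.

Lemma closure_lin_spanP A k u v : closure (lin_span A) u ->
  closure (lin_span A) v -> closure (lin_span A) (k *: u + v).
Proof.
move=> /closure_normP clu /closure_normP clv; apply/closure_normP => e e0.
have k0 : 0 < `|k| + 1 by rewrite ltr_pwDr.
have [s As us] : exists2 s, lin_span A s & `|u - s| < e / 2 / (`|k| + 1).
  by apply: clu; rewrite !divr_gt0.
have [t At vt] : exists2 t, lin_span A t & `|v - t| < e / 2.
  by apply: clv; rewrite divr_gt0.
exists (k *: s + t); first exact: lin_spanP.
rewrite opprD addrACA -scalerBr (le_lt_trans (ler_normD _ _))//.
rewrite [e in ltRHS]splitr; apply: ler_ltD => //; rewrite normrZ.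
rewrite (@le_trans _ _ ((`|k| + 1) * `|u - s|))// ?ler_wpM2r ?lerDl//.
by rewrite mulrC -ler_pdivlMr// ltW.
Qed.

End closure.

Section projection.
Context {R : realType} {H : completeNormedModType R}.
Variable D : {dot H for idfun}.
Hypothesis normD : forall h, `|h| ^+ 2 = D h h.

Lemma parallelogram (u v : H) :
  `|u - v| ^+ 2 = 2 * `|u| ^+ 2 + 2 * `|v| ^+ 2 - `|u + v| ^+ 2.
Proof. rewrite !(normDsqr normD) normrN dotNr; ring. Qed.

Variable A : set H.

(** The projection [p] is the limit of the filter of near-minimizers of the distance from [g] to the
    span. It lies in the closure only, so its minimality is transferred from the span by
    continuity. *)
Lemma orthogonal_projection g :
  exists2 p, closure (lin_span A) p & forall s, lin_span A s -> D (g - p) s = 0.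
Proof.
pose S := lin_span A; pose dist := [set `|g - s| ^+ 2 | s in S].
have lb : has_inf dist.
  split; first by exists (`|g - 0| ^+ 2), 0 => //; exact: lin_span0.
  by exists 0 => _ [s _ <-]; exact: sqr_ge0.
pose dl := inf dist; pose B e := S `&` [set s | `|g - s| ^+ 2 < dl + e].
pose F := filter_from [set e : R | 0 < e] B.
have dlle s : S s -> dl <= `|g - s| ^+ 2.
  by move=> Ss; apply: ge_inf; [exact: lb.2|exists s].
have FF : ProperFilter F.
  apply: filter_from_proper.
    apply: filter_from_filter; first by exists 1 => /=.
    move=> i j i0 j0; exists (Num.min i j) => /=; first by rewrite lt_min i0.
    by move=> s [Ss /= gs]; split; split => //=;
      rewrite (lt_le_trans gs)// lerD2l ge_min lexx ?orbT.
  move=> e e0; have [_ [s Ss <-] gs] := inf_adherent e0 lb.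
  by exists s.
(* Parallelogram law: the midpoint of [s] and [t] is in the span, hence at squared distance at least
   [dl] from [g]. *)
have close e s t : B e s -> B e t -> `|s - t| ^+ 2 <= 4 * e.
  move=> [Ss /= gs] [St /= gt].
  have -> : s - t = (g - t) - (g - s) by rewrite opprB [RHS]addrC addrA subrK.
  rewrite parallelogram.
  have -> : (g - t) + (g - s) = 2 *: (g - 2^-1 *: (s + t)).
    rewrite scalerBr scalerA divff// scale1r scaler_nat mulr2n addrACA -opprD.
    by rewrite [t + s]addrC.
  rewrite normrZ exprMn normr_nat.
  have := dlle (2^-1 *: (s + t)); move: (`|g - 2^-1 *: _| ^+ 2) => r Hr.
  have {Hr} : dl <= r.
    apply: Hr; rewrite -[_ *: _]addr0; apply: lin_spanP; last exact: lin_span0.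
    by rewrite -[s]scale1r; exact: lin_spanP.
  move: gs gt; lra.
have cF : cvg F.
  apply/cauchy_cvgP; apply: cauchy_exP => e e0.
  (* With this radius [close] gives a squared distance of at most e^2 / 2, strictly below e^2. *)
  have e2 : 0 < e ^+ 2 / 8 by rewrite divr_gt0 ?exprn_gt0.
  have [s Bs] : B (e ^+ 2 / 8) !=set0 by apply: (@filter_ex _ F); exists (e ^+ 2 / 8).
  exists s; exists (e ^+ 2 / 8) => // t Bt; rewrite -ball_normE /=.
  rewrite -(@ltr_pXn2r _ 2)// ?nnegrE//; last exact: ltW.
  rewrite (le_lt_trans (close _ _ _ Bs Bt))//.
  have : 0 < e ^+ 2 by rewrite exprn_gt0.
  lra.
pose p := lim F.
have Bp e : 0 < e -> exists2 s, B e s & `|p - s| < e.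
  move=> e0.
  have : F (B e `&` ball p e).
    by apply: filterI; [exists e|apply: cF; exact: nbhsx_ballx].
  by move=> /filter_ex[s [Bs]]; rewrite -ball_normE => ps; exists s.
exists p; first by apply/closure_normP => e /Bp[s [Ss _] ps]; exists s.
(* [p + s] is a limit of points [q + s] of the span, none of which is closer to [g]. *)
have gp s : S s -> dl <= `|g - p - s| ^+ 2.
  move=> Ss; rewrite leNgt; apply/negP => lt.
  have cont : (fun q => `|g - q - s| ^+ 2 : R) @ p --> `|g - p - s| ^+ 2.
    apply: (@continuous_comp _ _ _ (fun q => `|g - q - s|) (fun r => r ^+ 2)).
      apply: (@continuous_comp _ _ _ (fun q => g - q - s) (fun r => `|r|)).
        by apply: cvgB; [apply: cvgB; [exact: cvg_cst|exact: cvg_id]|exact: cvg_cst].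
      exact: norm_continuous.
    exact: exprn_continuous.
  have : F [set q | S q /\ `|g - q - s| ^+ 2 < dl].
    apply: filterI; first by exists 1 => //= t [].
    by apply: cF; apply: cvgr_lt cont _ lt.
  move=> /filter_ex[q [Sq]]; rewrite ltNge => /negP; apply.
  rewrite -addrA -opprD; apply: dlle.
  by rewrite -[q]scale1r; exact: lin_spanP.
have pdl : `|g - p| ^+ 2 <= dl.
  have cont : (fun q => `|g - q| ^+ 2 : R) @ p --> `|g - p| ^+ 2.
    apply: (@continuous_comp _ _ _ (fun q => `|g - q|) (fun r => r ^+ 2)).
      apply: (@continuous_comp _ _ _ (fun q => g - q) (fun r => `|r|)).
        by apply: cvgB; [exact: cvg_cst|exact: cvg_id].
      exact: norm_continuous.
    exact: exprn_continuous.
  apply/ler_addgt0Pr => e e0; rewrite leNgt; apply/negP => lt.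
  have : F (B e `&` [set q | dl + e < `|g - q| ^+ 2]).
    apply: filterI; first by exists e.
    by apply: cF; apply: cvgr_gt cont _ lt.
  by move=> /filter_ex[q [[_ /= /ltW]]]; rewrite leNgt => /negP.
move=> s Ss.
have [s0|s0] := eqVneq (D s s) 0.
  have : `|D (g - p) s| <= 0.
    rewrite (le_trans (CauchySchwarz normD _ _))//.
    move/eqP: s0; rewrite -normD sqrf_eq0 => /eqP ->.
    by rewrite mulr0.
  by rewrite normr_le0 => /eqP.
have s_gt0 : 0 < D s s by rewrite lt_neqAle eq_sym s0 -normD sqr_ge0.
(* The multiple of [s] closest to [g - p]: moving there would lower the squared distance by x^2 / y,
   so x = 0. *)
have /gp : S ((D (g - p) s / D s s) *: s).
  by rewrite -[_ *: _]addr0; apply: lin_spanP => //; exact: lin_span0.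
rewrite (normDsqr normD) normrN normrZ exprMn real_normK ?num_real//.
rewrite (normD s) dotNr dotZr => /(le_trans pdl).
set x := D (g - p) s; set y := D s s.
have -> : `|g - p| ^+ 2 + 2 * - (x / y * x) + (x / y) ^+ 2 * y =
  `|g - p| ^+ 2 - x ^+ 2 / y.
  by field.
rewrite lerBrDr gerDl pmulr_lle0 ?invr_gt0// => x2.
by apply/eqP; rewrite -sqrf_eq0 eq_le x2 sqr_ge0.
Qed.

End projection.

(** * The sewing lemma *)

Section sewing.
Context {R : realType} {V : normedModType R}.
Variables (T C theta : R) (Xi : R -> R -> V).
Hypothesis theta1 : 1 < theta.
Hypothesis C0 : 0 <= C.
Hypothesis Xi_additive : forall s u t, 0 <= s -> s <= u -> u <= t -> t <= T ->
  `|Xi s t - Xi s u - Xi u t| <= C * (t - s) `^ theta.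

(** [sewing_sum] with a free left endpoint, so that partitions can be cut and handled by induction;
    [a = 0] gives back [sewing_sum]. *)
Definition sew (a : R) (P : seq R) : V := \sum_(p <- zip (a :: P) P) Xi p.1 p.2.

Lemma sew_nil a : sew a [::] = 0.
Proof. by rewrite /sew big_nil. Qed.

Lemma sew_cons a b P : sew a (b :: P) = Xi a b + sew b P.
Proof. by rewrite /sew /= big_cons. Qed.

Lemma sew_cat a P Q : sew a (P ++ Q) = sew a P + sew (last a P) Q.
Proof.
elim: P a => [|b P IH] a /=; first by rewrite sew_nil add0r.
by rewrite !sew_cons IH addrA.
Qed.

Lemma path_lt_le_last (a : R) (P : seq R) : path <%R a P -> a <= last a P.
Proof.
elim: P a => //= b P IH a /andP[/ltW ab /IH]; exact: le_trans.
Qed.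

(** At s = u = t the additivity defect is - Xi a a, and it is bounded by C * 0^theta = 0. *)
Lemma Xi_diag (a : R) : 0 <= a -> a <= T -> Xi a a = 0.
Proof.
move=> a0 aT; have := Xi_additive a0 (lexx a) (lexx a) aT.
rewrite !subrr sub0r normrN powR0 ?mulr0; last by rewrite gt_eqF// (lt_trans ltr01).
by rewrite normr_le0 => /eqP.
Qed.

Definition sewing_const : R := 2 * C / (1 - 2 `^ (1 - theta)).

Lemma two_powR_lt1 : (2 : R) `^ (1 - theta) < 1.
Proof.
rewrite /powR pnatr_eq0 /= expR_lt1 pmulr_llt0; first by rewrite subr_lt0.
by rewrite ln_gt0// ltr1n.
Qed.

Lemma sewing_const_ge0 : 0 <= sewing_const.
Proof.
by rewrite divr_ge0 ?mulr_ge0// subr_ge0 ltW// two_powR_lt1.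
Qed.

(* The interval is cut at the two consecutive partition points surrounding its
   midpoint: both remaining pieces have at most half its length, and
   [sewing_const] is the fixed point of the resulting recursion. *)
Lemma sewing_bound (a : R) (P : seq R) : 0 <= a -> path <%R a P -> last a P <= T ->
  `|sew a P - Xi a (last a P)| <= sewing_const * (last a P - a) `^ theta.
Proof.
have [n] := ubnP (size P); elim: n => // n IH in a P *; rewrite ltnS => Pn a0 aP PT.
have [P0|P0] := eqVneq P [::].
  rewrite P0 /= sew_nil Xi_diag ?subrr ?normr0 ?(mulr_ge0 sewing_const_ge0)
    ?powR_ge0//.
  by rewrite P0 in PT.
set b := last a P in PT *.
have ab : a < b.
  rewrite /b; case: P {Pn PT b} P0 aP => //= v P _ /andP[av vP].
  exact: lt_le_trans av (path_lt_le_last vP).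
pose m := (a + b) / 2.
have am : a <= m by rewrite /m; lra.
have mb : m < b by rewrite /m; lra.
have hasm : has (fun x => m < x) P.
  apply/hasP; exists b => //; rewrite /b; case: (P) P0 => //= v Q _; exact: mem_last.
pose k := find (fun x => m < x) P.
have kP : (k < size P)%N by rewrite -has_find.
pose P1 := take k P; pose v := nth 0 P k; pose P2 := drop k.+1 P.
have PE : P = P1 ++ v :: P2 by rewrite -drop_nth// cat_take_drop.
have mv : m < v by exact: nth_find.
pose u := last a P1.
have um : u <= m.
  have: all (fun x => x <= m) (a :: P1).
    rewrite /= am; apply/allP => x /(nthP 0)[i].
    rewrite size_takel ?(ltnW kP)// => ik <-.
    rewrite nth_take//; have := before_find 0 ik.
    by move/negbT; rewrite -leNgt.
  by move/allP; apply; exact: mem_last.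
move: aP; rewrite PE cat_path /= -/u => /and3P[aP1 uv vP2].
have bE : b = last v P2 by rewrite /b PE last_cat.
have au : a <= u := path_lt_le_last aP1.
have vb : v <= b by rewrite bE; exact: path_lt_le_last.
have vT : v <= T := le_trans vb PT.
have v0 : 0 <= v by rewrite (le_trans a0)// (le_trans am)// ltW.
have H1 : `|sew a P1 - Xi a u| <= sewing_const * (u - a) `^ theta.
  apply: IH => //; first by rewrite size_takel ?(ltnW kP)// (leq_trans kP).
  by rewrite -/u (le_trans (ltW uv)).
have H2 : `|sew v P2 - Xi v b| <= sewing_const * (b - v) `^ theta.
  rewrite bE; apply: IH; rewrite -?bE//.
  rewrite size_drop (leq_trans _ Pn)//.
  by rewrite ltn_subrL (leq_ltn_trans _ kP).
have H3 := Xi_additive a0 au (ltW uv) vT.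
have H4 := Xi_additive a0 (le_trans au (ltW uv)) vb PT.
have av : a <= v := le_trans au (ltW uv).
(* Each outer piece gains a factor 2^(-theta); the two together gain 2^(1 - theta), which is below 1
   because theta > 1. *)
have half x : 0 <= x -> x <= (b - a) / 2 ->
    x `^ theta <= 2 `^ (- theta) * (b - a) `^ theta.
  move=> x0 xh.
  have -> : 2 `^ (- theta) * (b - a) `^ theta = ((b - a) / 2) `^ theta.
    rewrite powRM ?subr_ge0 ?(ltW ab)//  mulrC; congr (_ * _).
    by rewrite -powR_inv1// -powRrM mulN1r.
  rewrite ge0_ler_powR// ?nnegrE//; last by lra.
  by rewrite ltW// (lt_trans ltr01).
have H1' : (u - a) `^ theta <= 2 `^ (- theta) * (b - a) `^ theta.
  by apply: half; move: um au; rewrite /m; lra.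
have H2' : (b - v) `^ theta <= 2 `^ (- theta) * (b - a) `^ theta.
  by apply: half; move: mv vb; rewrite /m; lra.
have H3' : (v - a) `^ theta <= (b - a) `^ theta.
  rewrite ge0_ler_powR ?nnegrE ?subr_ge0 ?lerB ?(ltW ab)//.
  by rewrite ltW// (lt_trans ltr01).
rewrite sew_cat sew_cons -/u.
(* Besides the errors of the two outer pieces, two additivity defects appear, one for each cut
   point: hence the [2 * C] in [sewing_const]. *)
have -> : sew a P1 + (Xi u v + sew v P2) - Xi a b =
  (sew a P1 - Xi a u) + (sew v P2 - Xi v b)
   - (Xi a v - Xi a u - Xi u v) - (Xi a b - Xi a v - Xi v b).
  rewrite !opprB [RHS](AC ((2*2)*(1*2)*(1*2)) ((1*(5*3)*10)*(2*6)*(4*8)*(7*9))).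
  by rewrite /= !addNr !addr0.
rewrite (le_trans (ler_normB _ _))//.
rewrite (le_trans (lerD (ler_normB _ _) (lexx _)))//.
rewrite (le_trans (lerD (lerD (ler_normD _ _) (lexx _)) (lexx _)))//.
have p2 : 2 `^ (1 - theta) = 2 * 2 `^ (- theta).
  by rewrite powRD ?powRr1//; apply/implyP.
have := two_powR_lt1; rewrite p2 => lt1.
have sC : sewing_const * (1 - 2 * 2 `^ (- theta)) = 2 * C.
  by rewrite /sewing_const p2 divfK// subr_eq0 eq_sym lt_eqF.
have S0 := sewing_const_ge0.
have H1'' := ler_wpM2l S0 H1'.
have H2'' := ler_wpM2l S0 H2'.
have H3'' := ler_wpM2l C0 H3'.
have sC' := congr1 (fun x => x * (b - a) `^ theta) sC.
move: sC' => /=; rewrite mulrBr mulr1 mulrBl.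
move: H1 H2 H3 H4 H1'' H2'' H3''; lra.
Qed.

Lemma path_lt_le_mem_last (a x : R) (P : seq R) :
  path <%R a P -> x \in P -> x <= last a P.
Proof.
move=> + xP; case/splitPr: xP => P1 P2; rewrite cat_path last_cat /=.
by move=> /and3P[_ _ /path_lt_le_last].
Qed.

(** [sewing_bound] is applied to the part of [Q] inside each interval of [P]. Of the factor l^theta
    for an interval of length l, l^(theta - 1) is bounded by e^(theta - 1), and the remaining
    lengths add up. *)
Lemma sewing_refinement (e a : R) (P Q : seq R) : 0 <= e -> 0 <= a ->
    path <%R a P -> path <%R a Q -> {subset P <= Q} ->
    last a Q = last a P -> last a P <= T ->
    (forall p, p \in zip (a :: P) P -> p.2 - p.1 <= e) ->
  `|sew a Q - sew a P| <= sewing_const * e `^ (theta - 1) * (last a P - a).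
Proof.
move=> e0; elim: P a Q => [|v P IH] a Q a0 aP aQ PQ lQ lT Pe.
  have -> : Q = [::].
    case: Q aQ lQ {PQ} => //= w Q /andP[aw /path_lt_le_last wQ] Qa.
    by move: wQ; rewrite Qa leNgt aw.
  by rewrite subrr normr0 /= subrr mulr0.
have vQ : v \in Q by rewrite PQ// mem_head.
case/path.splitP: vQ => Q1 Q2 in aQ PQ lQ *.
move: aP aQ lQ lT; rewrite /= cat_path last_cat last_rcons.
move=> /andP[av vP] /andP[aQ1 vQ2] lQ lT.
have vT : v <= T by rewrite (le_trans _ lT)// path_lt_le_last.
have v0 : 0 <= v by rewrite (le_trans a0)// ltW.
have ve : v - a <= e by apply: (Pe (a, v)); rewrite mem_head.
rewrite sew_cat last_rcons sew_cons opprD addrACA (le_trans (ler_normD _ _))//.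
rewrite -[X in _ * (X - a)](subrK v) -addrA mulrDr [leLHS]addrC lerD//.
  apply: IH => //; last by move=> p pP; apply: Pe; rewrite inE pP orbT.
  move=> y yP; have : y \in rcons Q1 v ++ Q2 by apply: PQ; rewrite inE yP orbT.
  have vy : v < y by exact: (allP (lt_path_min vP)).
  rewrite mem_cat => /orP[/(path_lt_le_mem_last aQ1)|//].
  by rewrite last_rcons leNgt vy.
have := @sewing_bound a (rcons Q1 v) a0 aQ1; rewrite last_rcons => /(_ vT).
move=> /le_trans; apply; rewrite -[leRHS]mulrA ler_wpM2l ?sewing_const_ge0//.
have theta0 : 0 < theta by rewrite (lt_trans ltr01).
rewrite -(@mulr_powRB1 _ (v - a))// ?subr_ge0 ?(ltW av)//.
rewrite mulrC ler_wpM2r ?subr_ge0 ?(ltW av)//.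
by rewrite ge0_ler_powR// ?nnegrE ?subr_ge0// ltW.
Qed.

Hypothesis T0 : 0 < T.

Lemma mesh_ltP (P : seq R) e :
  mesh P < e -> forall p, p \in zip (0 :: P) P -> p.2 - p.1 < e.
Proof.
rewrite /mesh /intervals => + p pP; apply: le_lt_trans.
exact: (@Order.TotalTheory.le_bigmax_seq _ _ _ _ _ p xpredT (fun p => p.2 - p.1)).
Qed.

Lemma common_refinement P Q : itv_partition 0 T P -> itv_partition 0 T Q ->
  exists S, [/\ itv_partition 0 T S, {subset P <= S} & {subset Q <= S}].
Proof.
move=> [pP /eqP lP] [pQ /eqP lQ].
pose S := sort <=%R (undup (P ++ Q)).
have memS x : (x \in S) = (x \in P) || (x \in Q).
  by rewrite mem_sort mem_undup mem_cat.
have leT x : x \in S -> x <= T.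
  by rewrite memS => /orP[/(path_lt_le_mem_last pP)|/(path_lt_le_mem_last pQ)];
    rewrite ?lP ?lQ.
have pS : path <%R 0 S.
  rewrite lt_path_sortedE sort_lt_sorted undup_uniq andbT; apply/allP => x.
  by rewrite memS => /orP[|]; apply/allP; exact: lt_path_min.
have TS : T \in S.
  rewrite memS; apply/orP; left; case: (P) lP => [/= T00|v P' /= <-].
    by move: T0; rewrite -T00 ltxx.
  exact: mem_last.
exists S; split; [split => // |by move=> x xP; rewrite memS xP|
  by move=> x xQ; rewrite memS xQ orbT].
rewrite eq_le path_lt_le_mem_last// andbT.
apply: leT; case: (S) TS => //= v S' _; exact: mem_last.
Qed.

Lemma exists_partition_mesh e : 0 < e ->
  exists2 P, itv_partition 0 T P & mesh P < e.
Proof.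
move=> e0.
have equi (h : R) n (a : R) : 0 < h ->
    exists P, [/\ path <%R a P, last a P = a + h *+ n &
    forall p, p \in zip (a :: P) P -> p.2 - p.1 = h].
  move=> h0; elim: n a => [|n IH] a; first by exists [::]; rewrite addr0.
  have [P [aP lP hP]] := IH (a + h).
  exists (a + h :: P); split => /=.
  - by rewrite ltrDl h0.
  - by rewrite lP mulrS addrA.
  - by move=> p; rewrite inE => /predU1P[->/=|/hP//]; rewrite addrC addKr.
pose n := (Num.truncn (T / e)).+1.
have hn : T / n%:R < e.
  by rewrite ltr_pdivrMr// mulrC -ltr_pdivrMr// truncnS_gt.
have [P [aP lP hP]] := equi (T / n%:R) n 0 (divr_gt0 T0 (ltr0Sn _ _)).
exists P.
  by split => //; rewrite lP add0r -(mulr_natr (T / n%:R)) divfK// pnatr_eq0.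
rewrite /mesh big_seq; apply: bigmax_lt => // p pP.
by rewrite hP.
Qed.

Lemma mesh_to0_filter : ProperFilter (mesh_to0 T).
Proof.
apply: filter_from_proper.
  apply: filter_from_filter; first by exists 1 => /=.
  move=> i j i0 j0; exists (Num.min i j) => /=; first by rewrite lt_min i0.
  by move=> P [PT]; rewrite lt_min => /andP[].
by move=> e e0; have [P] := exists_partition_mesh e0; exists P.
Qed.

End sewing.

Lemma sewing_cvg (R : realType) (V : completeNormedModType R)
    (T C theta : R) (Xi : R -> R -> V) :
  0 < T -> 1 < theta -> 0 <= C ->
  (forall s u t, 0 <= s -> s <= u -> u <= t -> t <= T ->
     `|Xi s t - Xi s u - Xi u t| <= C * (t - s) `^ theta) ->
  cvg (sewing_sum Xi @ mesh_to0 T).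
Proof.
move=> T0 theta1 C0 Xi_additive; have FF := mesh_to0_filter T0.
apply/cauchy_cvgP; apply: cauchy_exP => eps eps0.
pose c := sewing_const C theta * T + 1.
have sC0 := sewing_const_ge0 theta1 C0.
have c0 : 0 < c by rewrite ltr_wpDl// mulr_ge0// ltW.
have t1 : theta - 1 != 0 by rewrite subr_eq0 gt_eqF.
(* Solves c * e^(theta - 1) = eps / 2; the [+ 1] in [c] makes c positive and the next estimate
   strict. *)
pose e := (eps / 2 / c) `^ (theta - 1)^-1.
have e0 : 0 < e by rewrite powR_gt0// !divr_gt0.
have ee : sewing_const C theta * e `^ (theta - 1) * T < eps / 2.
  rewrite /e -powRrM mulVf// powRr1; last by rewrite ltW// !divr_gt0.
  rewrite mulrAC mulrCA -[ltRHS]mulr1 ltr_pM2l ?divr_gt0//.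
  by rewrite ltr_pdivrMr// mul1r ltrDl.
have refine P S : itv_partition 0 T P -> mesh P < e -> itv_partition 0 T S ->
    {subset P <= S} -> `|sewing_sum Xi S - sewing_sum Xi P| < eps / 2.
  move=> [pP /eqP lP] Pe [pS /eqP lS] PS; apply: le_lt_trans ee.
  rewrite -[X in _ * X]subr0 -[in leRHS]lP; apply: (@sewing_refinement _ _ T) => //.
  - exact: ltW.
  - by rewrite lS.
  - by rewrite lP.
  - by move=> p /(mesh_ltP Pe)/ltW.
have [P PT Pe] := exists_partition_mesh T0 e0.
exists (sewing_sum Xi P); exists e => // Q [QT Qe].
rewrite -ball_normE /=.
(* Neither [P] nor [Q] need refine the other, so both are compared with a common refinement, each at
   cost eps / 2. *)
have [S [ST PS QS]] := common_refinement T0 PT QT.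
rewrite -(subrKA (sewing_sum Xi S)) (le_lt_trans (ler_normD _ _))//.
by rewrite [eps]splitr; apply: ltrD; [rewrite distrC|]; exact: refine.
Qed.

(** * Rough integrals *)

Section wsum.
Context {R : realType} {d : nat}.
Implicit Types V : zmodType.

Lemma eq_wsum V n (F G : word d -> V) :
  (forall I, (size I < n)%N -> F I = G I) -> wsum n F = wsum n G.
Proof.
by move=> FG; apply: eq_bigr => m _; apply: eq_bigr => I _; rewrite FG// size_tuple.
Qed.

Lemma wsumB V n (F G : word d -> V) :
  wsum n (fun I => F I - G I) = wsum n F - wsum n G.
Proof. by rewrite /wsum -sumrB; apply: eq_bigr => m _; rewrite -sumrB. Qed.

Lemma wsumD V n (F G : word d -> V) :
  wsum n (fun I => F I + G I) = wsum n F + wsum n G.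
Proof. by rewrite /wsum -big_split; apply: eq_bigr => m _; rewrite -big_split. Qed.

Lemma wsum_sumr V n (J : Type) (r : seq J) (F : word d -> J -> V) :
  wsum n (fun I => \sum_(j <- r) F I j) = \sum_(j <- r) wsum n (F^~ j).
Proof.
rewrite /wsum exchange_big; apply: eq_bigr => m _; exact: exchange_big.
Qed.

Lemma exchange_wsum V n m (F : word d -> word d -> V) :
  wsum n (fun I => wsum m (F I)) = wsum m (fun J => wsum n (F^~ J)).
Proof.
rewrite /(wsum m) wsum_sumr; apply: eq_bigr => k _; exact: wsum_sumr.
Qed.

Lemma wsum_raddf (U V : zmodType) (f : {additive U -> V}) n (F : word d -> U) :
  f (wsum n F) = wsum n (f \o F).
Proof. by rewrite raddf_sum; apply: eq_bigr => m _; rewrite raddf_sum. Qed.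

Lemma wsum_delta (V : lmodType R) n (L : word d) (F : word d -> V) :
  (size L < n)%N -> wsum n (fun J => (L == J)%:R *: F J) = F L.
Proof.
move=> Ln; rewrite /wsum (bigD1 (Ordinal Ln))//= (bigD1 (in_tuple L))//=.
rewrite eqxx scale1r big1 ?addr0 => [|I IL]; last first.
  by rewrite (_ : L == I = false) ?scale0r//; apply/negbTE; rewrite eq_sym.
rewrite big1 ?addr0// => m mL; rewrite big1// => I _.
rewrite (_ : L == I = false) ?scale0r//; apply/eqP => LI.
by move: mL; rewrite -val_eqE /= LI size_tuple eqxx.
Qed.

Lemma ler_norm_wsum (V : normedModType R) n (F : word d -> V) (G : word d -> R) :
  (forall I, (size I < n)%N -> `|F I| <= G I) -> `|wsum n F| <= wsum n G.
Proof.
move=> FG; rewrite (le_trans (ler_norm_sum _ _ _))// ler_sum// => m _.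
rewrite (le_trans (ler_norm_sum _ _ _))// ler_sum// => I _.
by rewrite FG// size_tuple.
Qed.

End wsum.

Section opnorm.
Context {R : realType} {d : nat} {H : normedModType R}.

Lemma ler_enorm (y : 'cV[R]_d) k : `|y k 0| <= enorm y.
Proof.
rewrite /enorm -(sqrtr_sqr (y k 0)) ler_wsqrtr// /dotv mxE (bigD1 k)//= mxE.
by rewrite -expr2 lerDl sumr_ge0// => i _; rewrite mxE -expr2 sqr_ge0.
Qed.

Lemma enorm_delta k : enorm (delta_mx k 0 : 'cV[R]_d) = 1.
Proof.
rewrite /enorm /dotv mxE (bigD1 k)//= !mxE !eqxx mulr1 big1 ?addr0 ?sqrtr1// => i ik.
by rewrite !mxE (negbTE ik) mul0r.
Qed.

(** [opnorm] is a real [sup], so it dominates its set only if that set is bounded. Here the bound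
    comes from finite dimension: the coordinates of a vector of the unit ball are at most 1 in
    absolute value. *)
Lemma ler_opnorm (A : 'cV[R]_d -> H) (y : 'cV[R]_d) : linear A ->
  enorm y <= 1 -> `|A y| <= opnorm A.
Proof.
move=> linA y1; apply: ub_le_sup; last by exists y.
pose A' := GRing.isLinear.Build _ _ _ _ A linA.
have [AL ALE] : exists AL : {linear 'cV[R]_d -> H}, AL =1 A.
  by exists (HB.pack A A' : {linear 'cV[R]_d -> H}).
exists (\sum_k `|A (delta_mx k 0)|) => _ [z z1 <-].
rewrite (matrix_sum_delta z) -ALE linear_sum.
rewrite (le_trans (ler_norm_sum _ _ _))// ler_sum// => k _.
rewrite big_ord1 linearZ_LR normrZ -ALE ler_piMl//.
exact: le_trans (ler_enorm _ _) z1.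
Qed.

End opnorm.

Section rough_integral.
Context {R : realType} {d : nat} {alpha T : R} {x : 'cV[R]_d}.
Context {K : stopped_path alpha x T -> stopped_path alpha x T -> 'M[R]_d}.
Context {HK : rkhs K}.
Variable KK : rough_path alpha x T -> R -> word d -> {linear 'cV[R]_d -> HK}.
Hypothesis hKK : controlled KK.
Hypothesis T0 : 0 < T.
Hypothesis halpha : 0 < alpha < 1.
Implicit Types X Y : rough_path alpha x T.
Local Notation N := (level alpha).

Definition germ X (s t : R) : HK := wsum N (fun I =>
  \sum_(k < d) X s t (rcons I k) *: KK X s I (delta_mx k 0)).

(** In Chen's relation for the word Ik, the cut after the last letter contributes the first term, as
    the coefficient of the empty word is 1. Every other cut leaves k in the right factor, the shape
    of the words in [germ X u t]. *)
Lemma chen_rcons X s u t I k : 0 <= s -> s <= u -> u <= t -> t <= T ->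
  (size I < N)%N ->
  X s t (rcons I k) = X s u (rcons I k) +
    \sum_(j < (size I).+1) X s u (take j I) * X u t (rcons (drop j I) k).
Proof.
move=> s0 su ut tT IN; have pX := rp_is_rough_path X.
rewrite -(rp_chen pX s0 su ut tT) ?size_rcons// /tmul size_rcons big_ord_recr /=.
rewrite -(size_rcons I k) take_size drop_size (rp_unit pX) ?mulr1; last first.
  by split => //=; exact: le_trans su.
rewrite addrC; congr (_ + _); rewrite size_rcons; apply: eq_bigr => j _.
by rewrite -!cats1 take_cat drop_cat; have := ltn_ord j; rewrite ltnS leq_eqVlt
  => /predU1P[->|->]; rewrite ?ltnn ?subnn ?take0 ?drop0 ?cats0 ?take_size ?drop_size.
Qed.

(* By Chen's relation, the additivity defect of the germ only involves the
   remainders of the controlled path. *)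
Lemma germ_defect X s u t : 0 <= s -> s <= u -> u <= t -> t <= T ->
  germ X s t - germ X s u - germ X u t =
  - wsum N (fun J => \sum_(k < d) X u t (rcons J k) *:
      (KK X u J (delta_mx k 0) -
       KK_apply KK X s (tmul (X s u) (eword J)) (delta_mx k 0))).
Proof.
move=> s0 su ut tT; rewrite /germ -!wsumB.
have -> : wsum N (fun J => \sum_(k < d) X u t (rcons J k) *:
      (KK X u J (delta_mx k 0) -
       KK_apply KK X s (tmul (X s u) (eword J)) (delta_mx k 0))) =
  wsum N (fun J => \sum_(k < d) X u t (rcons J k) *: KK X u J (delta_mx k 0)) -
  wsum N (fun J => \sum_(k < d) X u t (rcons J k) *:
       KK_apply KK X s (tmul (X s u) (eword J)) (delta_mx k 0)).
  rewrite -wsumB; apply: eq_wsum => J _.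
  by rewrite -sumrB; apply: eq_bigr => k _; rewrite scalerBr.
rewrite opprB wsumB; congr (_ - _).
transitivity (wsum N (fun I => \sum_(k < d)
    \sum_(j < (size I).+1) X s u (take j I) *:
      (X u t (rcons (drop j I) k) *: KK X s I (delta_mx k 0)))).
  apply: eq_wsum => I IN; rewrite -sumrB; apply: eq_bigr => k _.
  rewrite -scalerBl (chen_rcons _ _ s0 su ut tT)// addrAC subrr add0r scaler_suml.
  by apply: eq_bigr => j _; rewrite scalerA.
rewrite !wsum_sumr; apply: eq_bigr => k _.
transitivity (wsum N (fun J => wsum N (fun I =>
  X u t (rcons J k) *:
    (tmul (X s u) (eword J) I *: KK X s I (delta_mx k 0))))); last first.
  apply: eq_wsum => J _; rewrite /KK_apply.
  by rewrite (wsum_raddf ( *:%R (X u t (rcons J k)))).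
rewrite exchange_wsum; apply: eq_wsum => I IN.
(* [eword J] turns the product into a sum over the cuts of I whose suffix is J. Suffixes of I have
   length below N, so the sum over J retains each cut exactly once. *)
transitivity (wsum N (fun J => \sum_(j < (size I).+1) (drop j I == J)%:R *:
   (X s u (take j I) *:
     (X u t (rcons J k) *: KK X s I (delta_mx k 0))))); last first.
  apply: eq_wsum => J _; rewrite /tmul scaler_suml scaler_sumr.
  apply: eq_bigr => j _; rewrite /eword !scalerA; congr (_ *: _); ring.
rewrite wsum_sumr; apply: eq_bigr => j _.
by rewrite wsum_delta// size_drop (leq_ltn_trans (leq_subr _ _)).
Qed.

(** This is where N = floor(1 / alpha) enters: it makes the sewing exponent exceed 1. *)
Lemma level_gt : 1 < N.+1%:R * alpha.
Proof.
by have /andP[a0 a1] := halpha; rewrite -ltr_pdivrMr// mul1r truncnS_gt.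
Qed.

Lemma germ_bound X : exists2 C, 0 <= C & forall s u t,
  0 <= s -> s <= u -> u <= t -> t <= T ->
  `|germ X s t - germ X s u - germ X u t| <= C * (t - s) `^ (N.+1%:R * alpha).
Proof.
have [C HC] := rp_hoelder (rp_is_rough_path X).
have [_ [C' HC']] := hKK X.
have /andP[a0 a1] := halpha.
(* One copy of |C| |C'| per word and letter; the absolute values are there because [C] and [C'] come
   without a sign. *)
exists (wsum N (fun _ : word d => \sum_(k < d) `|C| * `|C'|)).
  apply: sumr_ge0 => m _; apply: sumr_ge0 => I _.
  by apply: sumr_ge0 => k _; exact: mulr_ge0.
move=> s u t s0 su ut tT; rewrite germ_defect// normrN.
rewrite [X in _ <= X](_ : _ = wsum N (fun _ : word d =>
    \sum_(k < d) `|C| * `|C'| * (t - s) `^ (N.+1%:R * alpha))); last first.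
  rewrite /wsum mulr_suml; apply: eq_bigr => m _.
  rewrite mulr_suml; apply: eq_bigr => I _.
  by rewrite mulr_suml.
apply: ler_norm_wsum => J JN; rewrite (le_trans (ler_norm_sum _ _ _))// ler_sum// => k _.
have ut0 : 0 <= t - u by rewrite subr_ge0.
have su0 : 0 <= u - s by rewrite subr_ge0.
have [HJ _] := HC' J s u JN s0 su (le_trans ut tT).
have sut : simplex T (u, t) by split => //=; exact: le_trans su.
have JkN : (size (rcons J k) <= N)%N by rewrite size_rcons.
have st0 : 0 <= t - s by rewrite subr_ge0 (le_trans su).
have powmono y q : 0 <= q -> 0 <= y -> y <= t - s -> y `^ q <= (t - s) `^ q.
  by move=> q0 y0 yts; rewrite ge0_ler_powR.
rewrite normrZ.
(* Hoelder exponent of X^{Jk} plus exponent of the remainder at J: the sum does not depend on J. *)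
have -> : N.+1%:R * alpha =
    (size (rcons J k))%:R * alpha + (N - size J)%:R * alpha.
  by rewrite -mulrDl -natrD size_rcons addSn subnKC// ltnW.
rewrite powRD; last first.
  by rewrite -mulrDl -natrD size_rcons mulf_eq0 pnatr_eq0 addSn/= gt_eqF.
rewrite mulrACA ler_pM//.
  rewrite (le_trans (HC _ _ sut _ JkN))//.
  rewrite (le_trans (ler_wpM2r (powR_ge0 _ _) (ler_norm C)))//.
  rewrite ler_wpM2l// powmono ?mulr_ge0 ?(ltW a0)//.
  by rewrite lerB.
have lin : linear (fun y => KK X u J y - KK_apply KK X s (tmul (X s u) (eword J)) y).
  move=> a y z; rewrite linearP scalerBr [RHS]addrACA -opprD; congr (_ - _).
  rewrite /KK_apply (wsum_raddf ( *:%R a)) -wsumD; apply: eq_wsum => I _ /=.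
  by rewrite linearP scalerDr !scalerA mulrC.
rewrite (le_trans (ler_opnorm lin _)) ?enorm_delta// (le_trans HJ)//.
rewrite (le_trans (ler_wpM2r (powR_ge0 _ _) (ler_norm C')))//.
rewrite ler_wpM2l// powmono ?mulr_ge0 ?(ltW a0)//.
by rewrite lerB.
Qed.

Lemma germ_cvg X : cvg (sewing_sum (germ X) @ mesh_to0 T).
Proof.
have [C C0 HC] := germ_bound X.
exact: (sewing_cvg T0 level_gt C0 HC).
Qed.

(** The sums defining [rough_int] are the images under <f, .> of those defining [Phi]. Convergence
    of the latter is essential, since [lim] is a mere default value otherwise. *)
Lemma rough_intE f X : rough_int KK f X = rk_dot HK f (Phi KK X).
Proof.
have FF := mesh_to0_filter T0.
rewrite /rough_int; apply: cvg_lim => //.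
rewrite (_ : sewing_sum _ = rk_dot HK f \o sewing_sum (germ X)); last first.
  apply/funext => P; rewrite /sewing_sum /= linear_sumr; apply: eq_bigr => p _.
  rewrite /germ (wsum_raddf (rk_dot HK f)); apply: eq_wsum => I _ /=.
  by rewrite linear_sumr; apply: eq_bigr => k _; rewrite linearZr_LR.
apply: continuous_cvg; last exact: germ_cvg.
exact: (continuous_dot (@rk_norm _ _ _ _ HK)).
Qed.

End rough_integral.

(** * Measurability and square integrability *)

(* Such a subspace is sigma-compact, hence an F_sigma set. *)
Lemma locally_compact_borel (T : ptopologicalType) (A : set T) :
  hausdorff_space T -> locally_compact [set: A] -> @second_countable A ->
  measurable (A : set (borel T)).
Proof.
move=> hT lcA [B cB [Bo Bb]].
pose cover b (U : set A) := compact U /\ b `<=` U.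
(* One compact set for each basic open set that is contained in some compact set; by local
   compactness these basic sets still cover [A], and there are countably many. *)
pose F b : set T := if pselect (exists U, cover b U) is left e
  then val @` (projT1 (cid e)) else set0.
have -> : A = \bigcup_(b : B) F (val b).
  rewrite -bigcup_set_type; apply/seteqP; split=> [p Ap|p [b _]].
    pose q : A := SigSub (mem_set Ap).
    have [U qU [cU _]] := lcA q I.
    have {}qU : nbhs q U.
      by move: qU; rewrite withinE /= => -[V qV]; rewrite !setIT => ->.
    have [b [Bb' bq] bU] := Bb q _ qU; exists b => //.
    rewrite /F; case: pselect => [e|]; last by case; exists U.
    by exists q => //; case: cid => /= V [_]; apply.
  rewrite /F; case: pselect => // e [q _ <-]; exact/set_mem/valP.
apply: countable_bigcupT_measurable => [|b].
  by rewrite (eq_countable (card_setT _)).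
rewrite /F; case: pselect => [e|_]; last exact: measurable0.
case: cid => /= U [cU _].
rewrite -[X in measurable X]setCK; apply: measurableC; apply: sub_sigma_algebra.
(* A compact subset of the subspace remains compact in [T], hence closed because [T] is
   Hausdorff. *)
apply: closed_openC; apply: compact_closed => //; apply: continuous_compact => //.
apply: continuous_subspaceT; exact: initial_continuous.
Qed.

Section weak_measurability.
Context {R : realType} {H : completeNormedModType R}.
Variable dot : {dot H for idfun}.
Hypothesis normE : forall h, `|h| ^+ 2 = dot h h.
Context {dsp : measure_display} {Om : measurableType dsp}.
Variables (D : set Om) (Phi : Om -> H).
Hypothesis Phi_meas : forall Y, D Y ->
  measurable_fun D (fun X => dot (Phi X) (Phi Y)).

(* [Phi_meas] says nothing about directions outside the closed span of
   [Phi @` D]; but those orthogonal to it do not see [Phi] on [D]. *)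
Lemma measurable_dot g : measurable_fun D (fun X => dot (Phi X) g).
Proof.
have [p clp gp] := orthogonal_projection normE (Phi @` D) g.
have gpE X : D X -> dot (Phi X) g = dot (Phi X) p.
  move=> DX; apply/eqP; rewrite -subr_eq0 -linearBr /=.
  by rewrite (dotC dot) gp//; apply: sub_lin_span; exists X.
apply: (@eq_measurable_fun _ _ _ _ D (fun X => dot (Phi X) p)).
  by move=> X /set_mem /gpE.
have /choice[s sP] n : exists s, lin_span (Phi @` D) s /\ `|p - s| < n.+1%:R^-1.
  by move/closure_normP : clp => /(_ n.+1%:R^-1)[|s]; [rewrite invr_gt0|exists s].
apply: (@measurable_fun_cvg _ _ _ D (fun n X => dot (Phi X) (s n))).
  move=> n; have [[m [c [a [aP ->]]]] _] := sP n.
  have -> : (fun X => dot (Phi X) (\sum_i c i *: a i)) =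
            (fun X => \sum_(i < m) c i * dot (Phi X) (a i)).
    apply/funext => X; rewrite linear_sumr; apply: eq_bigr => i _.
    exact: linearZr_LR.
  apply: measurable_sum => i; apply: measurable_funM => //.
  have [Y DY <-] := aP i; exact: Phi_meas.
move=> X DX; apply: (@continuous_cvg _ _ _ _ _ s (dot (Phi X)) p).
  exact: (continuous_dot normE).
apply/cvgrPdist_lt => e e0; near=> n.
have [_ /lt_trans] := sP n; apply.
near: n; exact: near_infty_natSinv_lt (PosNum e0).
Unshelve. all: by end_near. Qed.

End weak_measurability.

Section square_integrable.
Context {R : realType} {dsp : measure_display} {Om : measurableType dsp}.
Variables (mu : {finite_measure set Om -> \bar R}) (D : set Om).
Hypothesis mD : measurable D.
Implicit Types u v : Om -> R.

(** Measurability of [u] is a separate clause because that of u^2 says nothing about the sign of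
    [u]. *)
Definition sqint u :=
  measurable_fun D u /\ mu.-integrable D (EFin \o (fun X => u X ^+ 2)).

Lemma sqint_cst c : sqint (cst c).
Proof.
split; first exact: measurable_cst.
exact: (finite_measure_integrable_cst mu (c ^+ 2) mD).
Qed.

Lemma integrable_sqintM u v : sqint u -> sqint v ->
  mu.-integrable D (EFin \o (fun X => u X * v X)).
Proof.
move=> [mu' iu] [mv iv]; apply: le_integrable (integrableD mD iu iv) => //.
  by apply/measurable_EFinP; exact: measurable_funM.
move=> X _ /=; rewrite lee_fin normrM -[u X ^+ 2]real_normK ?num_real//.
rewrite -[v X ^+ 2]real_normK ?num_real// [leRHS]ger0_norm ?addr_ge0 ?sqr_ge0//.
have := sqr_ge0 (`|u X| - `|v X|).
have : 0 <= `|u X| * `|v X| by rewrite mulr_ge0.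
rewrite sqrrB; lra.
Qed.

Lemma sqintZ k u : sqint u -> sqint (fun X => k * u X).
Proof.
move=> [mu' iu]; split; first exact: measurable_funM.
apply: eq_integrable (integrableZl mD (k ^+ 2) iu) => // X _ /=.
by rewrite -EFinM exprMn.
Qed.

Lemma sqintD u v : sqint u -> sqint v -> sqint (fun X => u X + v X).
Proof.
move=> su sv; split; first by apply: measurable_funD; [exact: su.1|exact: sv.1].
have iuv := integrableZl mD 2 (integrable_sqintM su sv).
have := integrableD mD (integrableD mD su.2 iuv) sv.2.
apply: eq_integrable => // X _ /=.
by rewrite -EFinM -!EFinD sqrrD mulr_natl.
Qed.

Lemma sqintB u v : sqint u -> sqint v -> sqint (fun X => u X - v X).
Proof.
move=> su sv; have := sqintD su (sqintZ (-1) sv).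
by under eq_fun do rewrite mulN1r.
Qed.

Lemma Rintegral_sqr_expand t u v : sqint u -> sqint v ->
  \int[mu]_(X in D) (u X - t * v X) ^+ 2 =
  \int[mu]_(X in D) (u X ^+ 2) - 2 * t * \int[mu]_(X in D) (u X * v X)
  + t ^+ 2 * \int[mu]_(X in D) (v X ^+ 2).
Proof.
move=> su sv.
have iuv := integrable_sqintM su sv.
rewrite -!RintegralZl//; [|exact: sv.2].
have i1 := integrableZl mD (2 * t) iuv; have i2 := integrableZl mD (t ^+ 2) sv.2.
rewrite -RintegralB//; last exact: su.2.
rewrite -RintegralD//; last exact: (integrableB mD su.2 i1).
by apply: eq_Rintegral => X _; ring.
Qed.

(** [Lfun] concerns functions on the whole space, so a function on [D] enters it through its
    extension by zero. *)
Lemma Lfun2_sqint u : u \_ D \in Lfun mu 2%:E <-> sqint u.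
Proof.
split=> [uL|[mu' iu]].
  have mu' : measurable_fun D u.
    apply/(measurable_restrictT u mD); exact: set_mem (sub_Lfun_mfun uL).
  split => //; apply/integrable_mkcond => //.
  apply: eq_integrable (Lfun2_integrable_sqr uL) => // X _ /=.
  by rewrite !patchE; case: ifP => // _; rewrite expr0n.
rewrite inE; apply/andP; split; rewrite inE /=; first exact/(measurable_restrictT u mD).
rewrite /finite_norm unlock /=; apply: poweR_lty.
move: iu => /(integrable_mkcond _ mD)/(integrable_lty measurableT).
congr (_ < _)%E; apply: eq_integral => X _ /=; rewrite !patchE.
case: ifP => _; rewrite powR_mulrn// real_normK ?num_real//.
by rewrite -[RHS]/((0 ^+ 2 : R)%:E) expr0n.
Qed.

End square_integrable.

(** * Regularized least squares *)

Section regularized_least_squares.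
Context {R : realType} {H : completeNormedModType R}.
Variable dot : {dot H for idfun}.
Hypothesis normE : forall h, `|h| ^+ 2 = dot h h.
Context {dsp : measure_display} {Om : measurableType dsp}.
Variables (mu : {finite_measure set Om -> \bar R}) (D : set Om).
Hypothesis mD : measurable D.
Variable Phi : Om -> H.
Hypothesis Phi_meas : forall Y, D Y ->
  measurable_fun D (fun X => dot (Phi X) (Phi Y)).
Hypothesis Phi_int : mu.-integrable D (fun X => (dot (Phi X) (Phi X))%:E).
Variable A : set H.
Hypothesis Phi_sub : Phi @` D `<=` A.
Variable y : Om -> R.
Hypothesis y_sqint : sqint mu D y.
Variable lambda : R.
Hypothesis lambda0 : 0 < lambda.

(** In the application [A] is the range of Phi over all rough paths and [D] is [XX], so [G] may be
    larger than the closed span of Phi over [D]. *)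
Let G := closure (lin_span A).

Lemma sqint_dot g : sqint mu D (fun X => dot (Phi X) g).
Proof.
have mg := measurable_dot normE Phi_meas g.
split => //; apply: le_integrable (integrableZl mD (`|g| ^+ 2) Phi_int) => //.
  by apply/measurable_EFinP; exact: measurable_funX.
move=> X _ /=; rewrite lee_fin normrX -normE -exprMn normrX lerXn2r ?nnegrE//.
by rewrite mulrC (le_trans (CauchySchwarz normE _ _))// ler_norm.
Qed.

Definition residual g X := y X - dot (Phi X) g.

Lemma sqint_residual g : sqint mu D (residual g).
Proof. exact: (sqintB mD y_sqint (sqint_dot g)). Qed.

Definition ls_loss g : \bar R :=
  (\int[mu]_(X in D) (residual g X ^+ 2)%:E + (lambda / 2 * `|g| ^+ 2)%:E)%E.

Lemma ls_loss_fin g : ls_loss g =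
  (\int[mu]_(X in D) (residual g X ^+ 2) + lambda / 2 * `|g| ^+ 2)%:E.
Proof.
rewrite /ls_loss EFinD /Rintegral fineK//.
exact: integrable_fin_num (sqint_residual g).2.
Qed.

Lemma ls_loss_expand f g t : ls_loss (f + t *: g) = (ls_loss f +
  (t * (lambda * dot f g - 2 * \int[mu]_(X in D) (residual f X * dot (Phi X) g))
   + t ^+ 2 * (\int[mu]_(X in D) (dot (Phi X) g ^+ 2) + lambda / 2 * `|g| ^+ 2))%:E)%E.
Proof.
rewrite !ls_loss_fin -EFinD; congr (_%:E).
rewrite (@eq_Rintegral _ _ _ _ _ (fun X => (residual f X - t * dot (Phi X) g) ^+ 2)).
  rewrite (Rintegral_sqr_expand mD _ (sqint_residual f) (sqint_dot g)).
  rewrite (normDsqr normE) normrZ exprMn real_normK ?num_real// dotZr; by field.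
by move=> X _; rewrite /residual dotDr dotZr opprD addrA.
Qed.

Lemma linear_part_eq0 (b c : R) : (forall t, 0 <= t * b + t ^+ 2 * c) -> b = 0.
Proof.
move=> bc; have s0 : 0 < `|c| + 1 by rewrite ltr_pwDr.
(* A step against the sign of b, short enough for the quadratic term not to compensate, as |c| + 1 -
   c > 0. *)
have := bc (- b / (`|c| + 1)).
have -> : - b / (`|c| + 1) * b + (- b / (`|c| + 1)) ^+ 2 * c =
   - (b ^+ 2 * ((`|c| + 1 - c) / (`|c| + 1) ^+ 2)) by field; rewrite gt_eqF.
rewrite oppr_ge0 pmulr_lle0; last first.
  rewrite divr_gt0 ?exprn_gt0// addrAC ltr_wpDl// subr_ge0; exact: ler_norm.
by move=> b2; apply/eqP; rewrite -sqrf_eq0 eq_le b2 sqr_ge0.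
Qed.

(** Minimality allows variations in [G] only, but the equation is for all g in H. Replacing g by its
    projection [p] changes neither side: [f] lies in [G], and so does Phi_X for X in [D]. *)
Lemma ls_argminP f : G f -> is_argmin ls_loss G f <->
  forall g, lambda * dot f g = 2 * \int[mu]_(X in D) (residual f X * dot (Phi X) g).
Proof.
move=> Gf; split=> [[_ fmin] g|EL].
  have [p Gp gp] := orthogonal_projection normE A g.
  have fp : dot f (g - p) = 0.
    (* Orthogonality is known against the span only; approximating [f] by elements of the span
       extends it to the closure. *)
    apply/eqP; rewrite -normr_le0; apply/ler_addgt0Pr => e e0; rewrite add0r.
    move/closure_normP : Gf => /(_ (e / (`|g - p| + 1))).
    rewrite divr_gt0// ?ltr_pwDr// => /(_ isT)[s As fs].
    rewrite -(subrK s f) (dotDl dot) ((dotC dot) s) gp// addr0.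
    rewrite (le_trans (CauchySchwarz normE _ _))//.
    rewrite (@le_trans _ _ (`|f - s| * (`|g - p| + 1)))// ?ler_wpM2l ?lerDl//.
    by rewrite -ler_pdivlMr ?ltr_pwDr// ltW.
  have Phip X : D X -> dot (Phi X) g = dot (Phi X) p.
    move=> DX; apply/eqP; rewrite -subr_eq0 -linearBr /= (dotC dot) gp//.
    by apply: sub_lin_span; apply: Phi_sub; exists X.
  have -> : dot f g = dot f p by apply/eqP; rewrite -subr_eq0 -linearBr /= fp.
  have -> : \int[mu]_(X in D) (residual f X * dot (Phi X) g) =
            \int[mu]_(X in D) (residual f X * dot (Phi X) p).
    by apply: eq_Rintegral => X /set_mem DX; rewrite Phip.
  apply/eqP; rewrite -subr_eq0; apply/eqP; apply: linear_part_eq0 => t.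
  have /fmin : G (f + t *: p) by rewrite addrC; exact: closure_lin_spanP.
  by rewrite ls_loss_expand ls_loss_fin -EFinD lee_fin lerDl; apply.
(* Expansion at t = 1 in the direction g - f: the linear term vanishes and the quadratic one is
   nonnegative. *)
split => // g Gg; rewrite -(subrKC f g) -[g - f]scale1r.
rewrite ls_loss_expand ls_loss_fin -EFinD lee_fin lerDl EL subrr mulr0 add0r.
rewrite expr1n mul1r addr_ge0//.
  by apply: Rintegral_ge0 => X _; exact: sqr_ge0.
by rewrite mulr_ge0 ?sqr_ge0// divr_ge0// ltW.
Qed.

Lemma ls_argmin_dualP f : G f -> is_argmin ls_loss G f <->
  exists a : Om -> R,
    [/\ a \_ D \in Lfun mu 2%:E,
        {ae mu, forall X, D X -> 2^-1 * a X
           + lambda^-1 * \int[mu]_(Y in D) (a Y * dot (Phi Y) (Phi X)) = - y X} &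
        exists2 h : H, is_weak_integral dot mu D (fun X => a X *: Phi X) h &
          f = - lambda^-1 *: h].
Proof.
move=> Gf; have l0 : lambda != 0 by rewrite gt_eqF.
have weak a : sqint mu D a -> forall g,
    mu.-integrable D (fun X => (dot (a X *: Phi X) g)%:E).
  move=> sa g; have := integrable_sqintM mD sa (sqint_dot g).
  by apply: eq_integrable => // X _ /=; rewrite dotZl.
split=> [/(ls_argminP Gf) EL|[a [/(Lfun2_sqint mu mD) sa dual [h hP fh]]]].
  pose a X := - 2 * residual f X.
  have sa : sqint mu D a := sqintZ mD (- 2) (sqint_residual f).
  have aE g : \int[mu]_(X in D) (a X * dot (Phi X) g) = - lambda * dot f g.
    rewrite mulNr EL -mulNr -RintegralZl//.
      by apply: eq_Rintegral => X _; rewrite mulrA.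
    exact: (integrable_sqintM mD (sqint_residual f) (sqint_dot g)).
  exists a; split; first exact/(Lfun2_sqint mu mD).
    (* [aE] at g = Phi_X evaluates the integral operator, so the dual equation holds at every point
       of [D]. *)
    apply: aeW => X DX; rewrite aE (dotC dot) /a /residual; field.
    by [].
  exists (- lambda *: f) => [g|]; last by rewrite scalerA mulrNN mulVf// scale1r.
  split; first exact: weak.
  by rewrite dotZl -aE; apply: eq_Rintegral => X _; rewrite dotZl.
apply/(ls_argminP Gf) => g.
have hE k : dot h k = \int[mu]_(X in D) (a X * dot (Phi X) k).
  by rewrite (hP k).2; apply: eq_Rintegral => X _; rewrite dotZl.
(* Testing [h] against Phi_X turns the integral term into - <f, Phi_X>, so the dual equation says a
   = - 2 residual almost everywhere; this suffices under the integral. *)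
have aE : ae_eq mu D (fun X => (a X * dot (Phi X) g)%:E)
    (fun X => (- 2 * (residual f X * dot (Phi X) g))%:E).
  apply: filterS dual => X /[apply]; rewrite -hE => dualX; congr (_%:E).
  rewrite mulrA; congr (_ * _); rewrite /residual fh dotZr (dotC dot (Phi X)).
  by move: dualX => /(canRL (addrK _)); lra.
have -> : lambda * dot f g = - dot h g.
  by rewrite fh dotZl mulrA mulrN divff// mulN1r.
rewrite hE.
have ir := integrable_sqintM mD (sqint_residual f) (sqint_dot g).
rewrite -RintegralZl//.
rewrite -mulN1r -RintegralZl//; last exact: (integrable_sqintM mD sa (sqint_dot g)).
rewrite /Rintegral; congr (fine _); apply: ae_eq_integral => //.
- apply/measurable_EFinP; apply: measurable_funM => //; apply: measurable_funM => //.
    exact: sa.1.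
  exact: (sqint_dot g).1.
- apply/measurable_EFinP; apply: measurable_funM => //.
  apply: measurable_funM; [exact: (sqint_residual f).1|exact: (sqint_dot g).1].
by apply: filterS aE => X /[apply] -[->]; congr (_%:E); ring.
Qed.

End regularized_least_squares.

Theorem theorem1 (R : realType) (d : nat) (T alpha : R) (x : 'cV[R]_d)
    (hd : (0 < d)%N) (hT : 0 < T) (halpha : 0 < alpha < 1)
    (K : stopped_path alpha x T -> stopped_path alpha x T -> 'M[R]_d)
    (hK : operator_kernel K)
    (HK : rkhs K)
    (KK : rough_path alpha x T -> R -> word d -> {linear 'cV[R]_d -> HK})
    (hKK : controlled KK)
    (XX : set (rough_path alpha x T))
    (hXX_lc : locally_compact [set: XX])
    (hXX_sc : @second_countable XX)
    (hK_meas : measurable_fun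
       (XX `*` XX : set (borel (rough_path alpha x T) *
                         borel (rough_path alpha x T)))
       (fun p => K_Phi KK p.1 p.2))
    (Q : probability (borel (rough_path alpha x T)) R)
    (hQ : Q XX = 1%E)
    (payoff : rough_path alpha x T -> R)
    (hpayoff : measurable_fun [set: borel (rough_path alpha x T)] payoff)
    (pi0 : R)
    (hK_int : (\int[Q]_(X in XX) (K_Phi KK X X)%:E < +oo)%E)
    (hpayoff_int : (\int[Q]_(X in XX) (payoff X ^+ 2)%:E < +oo)%E)
    (lambda : R) (hlambda : 0 < lambda)
    (f : HK) (hf : H_Phi KK f) :
  is_argmin (hedging_loss KK Q XX payoff pi0 lambda) (H_Phi KK) f
  <->
  exists a : borel (rough_path alpha x T) -> R,
    [/\ a \_ XX \in Lfun Q 2%:E,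
        {ae Q, forall X, XX X ->
           2^-1 * a X + lambda^-1 * Xi_Phi KK Q XX a X = pi0 - payoff X} &
        exists2 h : HK,
          is_weak_integral (rk_dot HK) Q XX (fun X => a X *: Phi KK X) h &
          f = - lambda^-1 *: h].
Proof.
have hausT : hausdorff_space (rough_path alpha x T).
  exact: metric_hausdorff.
have mXX : measurable (XX : set (borel (rough_path alpha x T))).
  exact: locally_compact_borel.
have mXXXX : measurable (XX `*` XX : set (borel (rough_path alpha x T) *
                         borel (rough_path alpha x T))).
  exact: measurableX.
(* Joint measurability of [K_Phi] on [XX] is used along two embeddings into the product: a slice
   with [Y] fixed here, and the diagonal below. *)
have Phi_meas Y : XX Y -> measurable_fun (XX : set (borel (rough_path alpha x T)))
    (fun X => rk_dot HK (Phi KK X) (Phi KK Y)).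
  move=> XXY.
  apply: (@measurable_comp _ _ _ (borel (rough_path alpha x T))
    (borel (rough_path alpha x T) * borel (rough_path alpha x T))%type R
    (XX `*` XX) (fun p => K_Phi KK p.1 p.2) XX (fun X => (X, Y)) mXXXX _ hK_meas).
    by move=> _ [X XXX <-].
  apply: measurable_funTS.
  by apply: measurable_fun_pair; [exact: measurable_id|exact: measurable_cst].
have diag_meas : measurable_fun (XX : set (borel (rough_path alpha x T)))
    (fun X => rk_dot HK (Phi KK X) (Phi KK X)).
  apply: (@measurable_comp _ _ _ (borel (rough_path alpha x T))
    (borel (rough_path alpha x T) * borel (rough_path alpha x T))%type R
    (XX `*` XX) (fun p => K_Phi KK p.1 p.2) XX (fun X => (X, X)) mXXXX _ hK_meas).
    by move=> _ [X XXX <-].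
  by apply: measurable_funTS; apply: measurable_fun_pair; exact: measurable_id.
have Phi_int : Q.-integrable XX (fun X => (rk_dot HK (Phi KK X) (Phi KK X))%:E).
  apply/integrableP; split; first exact/measurable_EFinP.
  apply: le_lt_trans hK_int; rewrite le_eqVlt; apply/orP; left; apply/eqP.
  apply: eq_integral => X _ /=; rewrite ger0_norm//.
  by rewrite -(@rk_norm _ _ _ _ HK) sqr_ge0.
have payoff_sqint : sqint Q XX payoff.
  have mp : measurable_fun (XX : set (borel (rough_path alpha x T))) payoff.
    exact: measurable_funS hpayoff.
  split => //; apply/integrableP; split.
    by apply/measurable_EFinP; exact: measurable_funX.
  apply: le_lt_trans hpayoff_int; rewrite le_eqVlt; apply/orP; left; apply/eqP.
  by apply: eq_integral => X _ /=; rewrite ger0_norm// sqr_ge0.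
have y_sqint : sqint Q XX (fun X => payoff X - pi0).
  exact: (sqintB mXX payoff_sqint (sqint_cst Q mXX pi0)).
have Phi_sub : Phi KK @` XX `<=` range (Phi KK) by move=> _ [X _ <-]; exists X.
have lossE : hedging_loss KK Q XX payoff pi0 lambda =
    ls_loss (rk_dot HK) Q XX (Phi KK) (fun X => payoff X - pi0) lambda.
  apply/funext => g; rewrite /hedging_loss /ls_loss; congr (_ + _)%E.
  apply: eq_integral => X _.
  by rewrite (rough_intE hKK hT halpha) (dotC (rk_dot HK)).
rewrite lossE.
have -> := ls_argmin_dualP (@rk_norm _ _ _ _ HK) mXX Phi_meas Phi_int Phi_sub
  y_sqint hlambda hf.
split=> -[a [aL2 dual ah]]; exists a; split => //;
  apply: (@filterS _ _ (ae_filter_ringOfSetsType Q) _ _ _ dual) => X /[apply];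
  by rewrite opprB.
Qed.
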